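(* For every prime $m$, the function $g_m:\mathbb{N}\to\mathbb{N}$ is injective.
   Context: $\mathbb{N}=\{0,1,2,\dots\}$. For an integer $m\ge 2$, an $m$-product sequence is a finite sequence of integers $a_1\le a_2\le\dots\le a_t$ such that $\prod_{i=1}^t a_i=R^m$ for some $R\in\mathbb{N}$ and no integer appears more than $m-1$ times in the sequence. For $n\in\mathbb{N}$, $g_m(n)$ is the least integer $s$ such that there exists an $m$-product sequence $a_1\le\dots\le a_t$ with $a_1=n$ and $a_t=s$. *)

(* Defs.v *)
From mathcomp Require Import all_boot all_order all_algebra.
From mathcomp Require Import boolp.

Set Implicit Arguments.
Unset Strict Implicit.
Unset Printing Implicit Defensive.

Import Order.TTheory GRing.Theory Num.Theory.

Local Open Scope ring_scope.

Definition product_sequence (m : nat) (a : seq int) : Prop :=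
  [/\ sorted <=%R a,
      exists r : nat, \prod_(x <- a) x = r%:Z ^+ m
    & forall x : int, (count_mem x a <= m - 1)%N].

Definition product_sequence_from_to (m : nat) (n : nat) (s : int) : Prop :=
  exists a : seq int,
    [/\ product_sequence m a, a != [::], head 0 a = n%:Z & last 0 a = s].

Lemma product_sequence_exists (m n : nat) : (1 < m)%N ->
  exists s : nat, `[< product_sequence_from_to m n s%:Z >].
Proof.
case: m => [|[|k]] // _.
have [->|n0] := posnP n.
  exists 0%N; apply/asboolP; exists [:: 0]; split=> //; split=> //.
  - by exists 0%N; rewrite big_seq1 expr0n.
  - by move=> x /=; rewrite addn0; case: (_ == _).
exists (2 ^ k.+2 * n)%N; apply/asboolP.
exists (rcons (nseq k.+1 n%:Z) (2 ^ k.+2 * n)%N%:Z).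
have lt_n : (n < 2 ^ k.+2 * n)%N by rewrite ltn_Pmull // -{1}(expn0 2) ltn_exp2l.
split; [split | by [] | by [] | by rewrite last_rcons].
- have: (n <= 2 ^ k.+2 * n)%N by apply: ltnW.
  move: (2 ^ k.+2 * n)%N => p le_np; rewrite /=.
  by elim: k {lt_n} => [|k IHk] /=; rewrite ?lez_nat ?le_np ?leqnn.
- exists (2 * n)%N; rewrite -cats1 big_cat big_seq1.
  rewrite big_nseq iter_mulr_1 -!natz -!natrX /= -natrM.
  by rewrite expnMn mulnCA -expnSr.
- move=> x; rewrite -cats1 count_cat count_nseq /= addn0 subn1.
  have [<-|_] := eqVneq n%:Z x; last by rewrite mul0n add0n; apply: leq_trans (leq_b1 _) _.
  by rewrite mul1n eqz_nat gtn_eqF // addn0.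
Qed.

Definition g (m : nat) (m_ge2 : (1 < m)%N) (n : nat) : nat :=
  ex_minn (product_sequence_exists n m_ge2).

(* The minimum defining [g] ranges over [nat]; it is also the least integer. *)
Lemma g_least (m : nat) (m_ge2 : (1 < m)%N) (n : nat) :
  product_sequence_from_to m n (g m_ge2 n)%:Z /\
  forall s : int, product_sequence_from_to m n s -> (g m_ge2 n)%:Z <= s.
Proof.
rewrite /g; case: ex_minnP => p /asboolP p_n p_min; split=> // s s_n.
have s_ge0 : 0 <= s.
  case: s_n => -[|x a] [[srt _ _] //= _ hx <-].
  have: all (>= x) a := order_path_min le_trans srt.
  move=> /allP xa; have : last x a \in x :: a by apply: mem_last.
  by rewrite inE => /orP[/eqP->|/xa]; [|apply: le_trans]; rewrite hx.
by case: s s_ge0 s_n => // s _ s_n; rewrite lez_nat p_min //; apply/asboolP.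
Qed.

(* Main.v *)
(* The values of an [m]-product sequence have multiplicities in [0, m - 1],
   which are read as elements of the field F_m.  If n < n' and sequences for n
   and n' both end at s, adding to the first the multiple of the second that
   cancels the multiplicity of s modulo m gives a sequence that still starts
   at n and ends before s. *)
Require Import Defs.
From mathcomp Require Import all_boot.
From mathcomp Require Import order ssralg ssrnum ssrint.

Set Implicit Arguments.
Unset Strict Implicit.
Unset Printing Implicit Defensive.

Lemma prod_int_of_nat (l : seq nat) :
  (\prod_(x <- map Posz l) x)%R = Posz (\prod_(x <- l) x).
Proof.
by elim: l => [|x l IHl] /=; rewrite ?big_nil ?big_cons // IHl -PoszM.
Qed.

Lemma expn_prod (s : seq nat) (F : nat -> nat) (k : nat) :
  (\prod_(x <- s) F x) ^ k = \prod_(x <- s) F x ^ k.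
Proof. exact: (big_morph (expn^~ k) (fun a b => expnMn a b k) (exp1n k)). Qed.

Lemma prod_count (l : seq nat) (i j : nat) :
  {in l, forall x, i <= x < j} ->
  \prod_(x <- l) x = \prod_(i <= x < j) x ^ count_mem x l.
Proof.
elim: l => [|y l IHl] l_ij.
  by rewrite big_nil big1_seq // => x _; rewrite expn0.
rewrite big_cons IHl => [|x xl]; last by apply: l_ij; rewrite inE xl orbT.
have y_ij : y \in index_iota i j by rewrite mem_index_iota l_ij ?mem_head.
under [RHS]eq_bigr => x _ do rewrite /= expnD.
rewrite big_split; congr (_ * _)%N.
rewrite (bigD1_seq y) ?iota_uniq //= eqxx expn1 big1 ?muln1 // => x /negbTE.
by rewrite eq_sym => ->.
Qed.

Definition seq_of_mult (c : nat -> nat) (i j : nat) : seq nat :=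
  flatten [seq nseq (c x) x | x <- index_iota i j].

Lemma mem_seq_of_mult (c : nat -> nat) (i j y : nat) :
  (y \in seq_of_mult c i j) = (i <= y < j) && (0 < c y).
Proof.
apply/flatten_mapP/andP => [[x]|[y_ij cy]].
  by rewrite mem_index_iota mem_nseq => x_ij /andP[cx /eqP->].
by exists y; rewrite ?mem_index_iota // mem_nseq cy eqxx.
Qed.

(** Only an upper bound, because a value outside [i, j) does not occur at all, whatever [c] assigns
    to it. *)
Lemma count_seq_of_mult (c : nat -> nat) (i j y : nat) :
  count_mem y (seq_of_mult c i j) <= c y.
Proof.
have := iota_uniq i (j - i); rewrite /seq_of_mult /index_iota.
elim: (iota _ _) => //= x s IHs /andP[x_s s_uniq].
rewrite count_cat count_nseq /=.
have [<-|_] := eqVneq x y; last by rewrite add0n IHs.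
rewrite mul1n (count_memPn _) ?addn0 //.
apply/flatten_mapP => -[z zs]; rewrite mem_nseq => /andP[_ /eqP xz].
by rewrite xz zs in x_s.
Qed.

Lemma prod_seq_of_mult (c : nat -> nat) (i j : nat) :
  \prod_(x <- seq_of_mult c i j) x = \prod_(i <= x < j) x ^ c x.
Proof.
rewrite big_flatten big_map; apply: eq_bigr => x _.
by rewrite big_nseq iter_muln_1.
Qed.

(** The first entry [n] is a natural number and the least one, so no entry is negative. The order of
    the entries is then traded for membership and range, which is all that an argument on
    multiplicities needs. *)
Lemma product_sequence_nat (m n s : nat) :
  product_sequence_from_to m n (Posz s) ->
  exists l : seq nat,
    [/\ n \in l, s \in l, {in l, forall x, n <= x <= s},
        exists r, \prod_(x <- l) x = r ^ m
      & forall x, count_mem x l <= m - 1].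
Proof.
case=> -[|z a] [] // [a_sorted [r a_prod] a_count] _ /= zn a_last.
have le_n x : x \in z :: a -> (Posz n <= x)%R.
  rewrite -zn inE => /orP[/eqP->//|].
  exact/allP/(order_path_min Order.POrderTheory.le_trans).
have le_s x : x \in z :: a -> (x <= Posz s)%R.
  rewrite -a_last => xa.
  have /(sorted_leq_nth Order.POrderTheory.le_trans Order.POrderTheory.lexx 0%R)
    := a_sorted.
  move=> /(_ (index x (z :: a)) (size a)); rewrite !inE index_mem xa /= ltnSn.
  have ix : index x (z :: a) <= size a.
    by rewrite -ltnS -/(size (z :: a)) index_mem.
  by move=> /(_ isT isT ix); rewrite nth_index // nth_last.
have [l def_l] : exists l : seq nat, z :: a = map Posz l.
  exists (map absz (z :: a)); rewrite -map_comp -[LHS]map_id.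
  apply/eq_in_map => x /le_n /= /(Order.POrderTheory.le_trans _) x0.
  by case: x x0 => // x /(_ 0%R isT).
have Posz_inj : injective Posz by move=> x y [].
have mem_l x : (x \in l) = (Posz x \in z :: a) by rewrite def_l mem_map.
exists l; split.
- by rewrite mem_l -zn mem_head.
- by rewrite mem_l -a_last mem_last.
- by move=> x; rewrite mem_l => xa; rewrite -!lez_nat le_n ?le_s.
- exists r; apply: Posz_inj; rewrite -prod_int_of_nat -def_l a_prod.
  by rewrite -!natz GRing.natrX.
- move=> x; have := a_count (Posz x); rewrite def_l count_map.
  by rewrite (@eq_count _ _ (pred1 x)).
Qed.

(** Sorting restores a genuine product sequence: its head is the minimum [n], and its last entry,
    being a member of [l], lies below [s]. *)
Lemma product_sequence_of_nat (m n s : nat) (l : seq nat) :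
  n \in l -> {in l, forall x, n <= x < s} ->
  (exists r, \prod_(x <- l) x = r ^ m) ->
  (forall x, count_mem x l <= m - 1) ->
  exists2 t, t < s & product_sequence_from_to m n (Posz t).
Proof.
move=> nl l_ns [r l_prod] l_count.
have ls : perm_eq (sort leq l) l by rewrite perm_sort.
have s_sorted : sorted leq (sort leq l) := sort_sorted leq_total l.
have mem_ls := perm_mem ls.
case def_b: (sort leq l) ls s_sorted mem_ls => [|y b] b_perm b_sorted mem_b.
  by rewrite -mem_b in nl.
have yn : y = n.
  apply/eqP; rewrite eqn_leq; apply/andP; split.
    move: nl; rewrite -mem_b inE => /orP[/eqP->//|].
    exact/allP/(order_path_min leq_trans).
  by have /l_ns/andP[] : y \in l by rewrite -mem_b mem_head.
exists (last y b).
  by have /l_ns/andP[] : last y b \in l by rewrite -mem_b mem_last.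
exists (map Posz (y :: b)); split; last 3 first.
- by [].
- by rewrite /= yn.
- by rewrite /= last_map.
split.
- by rewrite sorted_map.
- exists r; rewrite prod_int_of_nat (perm_big _ b_perm) l_prod.
  by rewrite -!natz GRing.natrX.
- case=> x; rewrite count_map.
    rewrite (@eq_count _ _ (pred1 x)) //.
    by move/permP: b_perm => ->.
  by rewrite (@eq_count _ _ pred0) // count_pred0.
Qed.

(** A nonzero residue modulo a prime is invertible; this is where primality matters, beyond being at
    least 2. *)
Lemma cancel_mod_prime (p a b : nat) : prime p -> 0 < b < p ->
  exists k, p %| a + k * b.
Proof.
move=> p_prime /andP[b_gt0 lt_bp].
have : coprime p b by rewrite prime_coprime // gtnNdvd.
case/(coprimeP _ (prime_gt0 p_prime)) => -[u v] /= uv1.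
have def_up : u * p = v * b + 1 by rewrite -uv1 subnKC // ltnW // -subn_gt0 uv1.
(* By the Bezout relation, [v] is -1/b modulo [p], and a + a v b = a u p. *)
exists (a * v); rewrite -mulnA -mulnS -addn1 -def_up mulnA.
exact: dvdn_mull.
Qed.

(** The quotients of the exponents by [m] contribute a factor q^m. As q^m divides r^m, q divides r,
    and (r/q)^m is what remains; bases are positive, so q^m can be cancelled. *)
Lemma power_of_mod_exponents (m i j : nat) (e : nat -> nat) : 0 < m -> 0 < i ->
  (exists r, \prod_(i <= x < j) x ^ e x = r ^ m) ->
  exists r, \prod_(i <= x < j) x ^ (e x %% m) = r ^ m.
Proof.
move=> m_gt0 i_gt0 [r e_prod].
pose q := \prod_(i <= x < j) x ^ (e x %/ m).
pose u := \prod_(i <= x < j) x ^ (e x %% m).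
have def_r : r ^ m = q ^ m * u.
  rewrite -e_prod /q expn_prod -big_split; apply: eq_bigr => x _.
  by rewrite /= -expnM -expnD -divn_eq.
have q_gt0 : 0 < q.
  rewrite /q big_seq; apply: prodn_cond_gt0 => x; rewrite mem_index_iota.
  by case/andP=> le_ix _; rewrite expn_gt0 (leq_trans i_gt0 le_ix).
have /dvdnP[w def_w] : q %| r by rewrite -(dvdn_pexp2r _ _ m_gt0) def_r dvdn_mulr.
exists w; apply/eqP; rewrite -/u -(@eqn_pmul2l (q ^ m)) ?expn_gt0 ?q_gt0 //.
by rewrite -def_r def_w expnMn mulnC.
Qed.

Lemma product_sequence_lower_end (m n1 n2 s : nat) :
  prime m -> 0 < n1 < n2 ->
  product_sequence_from_to m n1 (Posz s) ->
  product_sequence_from_to m n2 (Posz s) ->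
  exists2 t, t < s & product_sequence_from_to m n1 (Posz t).
Proof.
move=> m_prime /andP[n1_gt0 lt_n].
case/product_sequence_nat=> a [n1a sa a_range [ra a_prod] a_count].
case/product_sequence_nat=> b [n2b sb b_range [rb b_prod] b_count].
have m_gt0 := prime_gt0 m_prime.
have lt_m l x : count_mem x l <= m - 1 -> count_mem x l < m.
  by rewrite subn1 -ltnS prednK.
have bs : 0 < count_mem s b < m by rewrite -has_count has_pred1 sb lt_m.
have [k k_cancel] := cancel_mod_prime (count_mem s a) m_prime bs.
have lt_n1s : n1 < s by case/andP: (b_range _ n2b) => _; apply: leq_trans.
(* The exponents in the product of the first sequence and the [k]-th power of the second. *)
pose e x := count_mem x a + k * count_mem x b.
have e_prod : exists r, \prod_(n1 <= x < s.+1) x ^ e x = r ^ m.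
  exists (ra * rb ^ k); rewrite expnMn -a_prod expnAC -b_prod.
  rewrite (prod_count (i := n1) (j := s.+1)) //.
  rewrite (@prod_count b n1 s.+1) => [|x /b_range/andP[le_x]]; last first.
    by rewrite (leq_trans (ltnW lt_n) le_x).
  rewrite expn_prod -big_split; apply: eq_bigr => x _.
  by rewrite /= -expnM -expnD mulnC.
have [r c_prod] := power_of_mod_exponents m_gt0 n1_gt0 e_prod.
pose c x := e x %% m.
apply: (@product_sequence_of_nat _ _ _ (seq_of_mult c n1 s)).
(* Entries of [b] are at least n2 > n1, so [n1] keeps its multiplicity from [a], which is positive
   and below [m] and hence survives reduction. *)
- rewrite mem_seq_of_mult leqnn lt_n1s /c /e (count_memPn _ : count_mem n1 b = 0).
    by rewrite muln0 addn0 modn_small ?lt_m // -has_count has_pred1.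
  by apply/negP => /b_range; rewrite leqNgt lt_n.
- by move=> x; rewrite mem_seq_of_mult => /andP[].
(* By the choice of [k], the reduced exponent of [s] is 0, so dropping [s] from the range leaves the
   product unchanged. *)
- exists r; rewrite prod_seq_of_mult -c_prod big_nat_recr 1?ltnW //=.
  by rewrite (eqP k_cancel) expn0 muln1.
- move=> x; apply: leq_trans (count_seq_of_mult _ _ _ _) _.
  by rewrite subn1 -ltnS prednK // ltn_pmod.
Qed.

Lemma g_neq (m : nat) (m_prime : prime m) (n1 n2 : nat) : n1 < n2 ->
  g (prime_gt1 m_prime) n1 <> g (prime_gt1 m_prime) n2.
Proof.
move=> lt_n eq_g.
have [seq1 min1] := g_least (prime_gt1 m_prime) n1.
have [seq2 _] := g_least (prime_gt1 m_prime) n2.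
rewrite -eq_g in seq2.
(* Cancelling m-th powers requires positive entries, so n1 = 0 is treated apart: the sequence
   [[:: 0]] gives the value 0 at 0, whereas the value at n2 is at least n2 > 0. *)
have [n1_0|n1_gt0] := posnP n1; last first.
  have n12 : 0 < n1 < n2 by rewrite n1_gt0.
  have [t lt_t /min1] := product_sequence_lower_end m_prime n12 seq1 seq2.
  by rewrite lez_nat leqNgt lt_t.
have seq0 : product_sequence_from_to m n1 0%N.
  exists [:: 0%R]; split; rewrite ?n1_0 //; split=> [//||x].
    by exists 0; rewrite big_seq1 GRing.expr0n gtn_eqF // prime_gt0.
  by rewrite /= addn0 (leq_trans (leq_b1 _)) // subn_gt0 prime_gt1.
have := min1 _ seq0; rewrite lez_nat leqn0 => /eqP g0.
have [l [n2l _ /(_ _ n2l)/andP[_]]] := product_sequence_nat seq2.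
by rewrite g0 leqNgt (leq_ltn_trans _ lt_n).
Qed.

Theorem theorem5p1 : forall (m : nat) (m_prime : prime m),
  injective (g (prime_gt1 m_prime)).
Proof.
move=> m m_prime n1 n2 eq_g.
have [lt_n|lt_n|//] := ltngtP n1 n2; first by case: (g_neq lt_n eq_g).
by case: (g_neq lt_n (esym eq_g)).
Qed.
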